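(* Let $f:\mathbb{R}^d\to\mathbb{R}$ be of class $C^2$, let $C>4$, and suppose $x^*$ is a non-degenerate saddle point of $f$. Let $\kappa$ be the condition number of the Hessian $D^2 f(x^* )$. Then for all $r>0$ sufficiently small, any trajectory of the normalized gradient descent (NGD) equation $$\dot{\mathbf{x}} = -\frac{\nabla f(\mathbf{x})}{\|\nabla f(\mathbf{x})\|}$$ that does not reach or converge to $x^*$ can spend time at most $C\sqrt{\kappa}\,r$ in the ball $B_r(x^* )$. That is, there is $\bar r>0$ such that for every $r\in(0,\bar r)$: if $\mathbf{x}_{x_0}$ is a solution of the NGD equation with initial condition $x_0$ and maximal interval of existence $[0,T_{x_0})$, $T_{x_0}\le\infty$, and $x^*\notin \mathrm{cl}(\gamma_{x_0}^+)$, then $$\mathcal{L}^1\Big(\big\{t\in[0,T_{x_0}) : \mathbf{x}_{x_0}(t)\in B_r(x^* )\big\}\Big)\le C\sqrt{\kappa}\,r.$$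
   Context: $\|\cdot\|$ is the Euclidean norm, $\mathcal{L}^1$ is one-dimensional Lebesgue measure, $B_r(x)$ is the ball of radius $r$ about $x$, and $\mathrm{cl}$ denotes closure. A saddle point of $f$ is a critical point that is neither a local minimum nor a local maximum; it is non-degenerate if $D^2 f(x^* )$ is non-singular. The condition number of a (non-singular symmetric) matrix $A$ is $\max\{|\lambda|:\lambda\in\sigma(A)\}/\min\{|\lambda|:\lambda\in\sigma(A)\}$, where $\sigma(A)$ is the spectrum of $A$. Solutions (trajectories) are classical: a solution of the NGD equation with initial condition $x_0$ (where $\nabla f(x_0)\neq0$) is a $C^1$ curve on an interval $[0,T)$ with value $x_0$ at $t=0$ satisfying the equation at every $t\in[0,T)$ (in particular not meeting critical points of $f$ on $[0,T)$); it is always taken on its maximal interval of existence $[0,T_{x_0})$, on which it is unique. The orbit of $x_0$ is $\gamma_{x_0}^+ := \{x\in\mathbb{R}^d : \mathbf{x}_{x_0}(t)=x \text{ for some } t\in[0,T_{x_0})\}$. *)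

(* Defs.v *)
From mathcomp Require Import all_boot all_order all_algebra.
From mathcomp Require Import all_classical all_reals all_analysis.
Import Order.TTheory GRing.Theory Num.Theory.
Import numFieldNormedType.Exports.

Set Implicit Arguments.
Unset Strict Implicit.
Unset Printing Implicit Defensive.

Local Open Scope classical_set_scope.
Local Open Scope ring_scope.

(* Points of R^d are row vectors.  The library norm on 'rV[R]_d is the sup norm:
   it is used only through the topology and the differential, which do not
   depend on the choice of norm.  Lengths and balls are Euclidean. *)
Definition enorm (R : realType) (d : nat) (v : 'rV[R]_d) : R :=
  Num.sqrt (\sum_(i < d) v 0 i ^+ 2).

Definition eball (R : realType) (d : nat) (x : 'rV[R]_d) (r : R)
    : set 'rV[R]_d :=
  [set y | enorm (y - x) < r].

Definition grad (R : realType) (d : nat) (f : 'rV[R]_d -> R) (x : 'rV[R]_d)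
    : 'rV[R]_d :=
  \row_(i < d) 'D_(delta_mx 0 i) f x.

Definition hessian (R : realType) (d : nat) (f : 'rV[R]_d -> R) (x : 'rV[R]_d)
    : 'M[R]_d :=
  jacobian (grad f) x.

Definition classC2 (R : realType) (d : nat) (f : 'rV[R]_d -> R) : Prop :=
  [/\ forall x, differentiable f x,
      forall x, differentiable (grad f) x
    & continuous (hessian f)].

Definition local_min (R : realType) (d : nat) (f : 'rV[R]_d -> R)
    (x : 'rV[R]_d) : Prop :=
  \forall y \near x, f x <= f y.

Definition local_max (R : realType) (d : nat) (f : 'rV[R]_d -> R)
    (x : 'rV[R]_d) : Prop :=
  \forall y \near x, f y <= f x.

Definition saddle_point (R : realType) (d : nat) (f : 'rV[R]_d -> R)
    (x : 'rV[R]_d) : Prop :=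
  [/\ grad f x = 0, ~ local_min f x & ~ local_max f x].

Definition nondegenerate_at (R : realType) (d : nat) (f : 'rV[R]_d -> R)
    (x : 'rV[R]_d) : Prop :=
  hessian f x \in unitmx.

(* Only real eigenvalues are collected; this is the whole spectrum when A is
   symmetric. *)
Definition spectrum (R : realType) (d : nat) (A : 'M[R]_d) : set R :=
  [set l | eigenvalue A l].

(* The spectrum is finite, so when it is nonempty this sup and this inf are
   the maximum and the minimum of |l| over the spectrum. *)
Definition condition_number (R : realType) (d : nat) (A : 'M[R]_d) : R :=
  sup [set `|l| | l in spectrum A] / inf [set `|l| | l in spectrum A].

Definition time_interval (R : realType) (T : \bar R) : set R :=
  [set t | 0 <= t /\ (t%:E < T)%E].

(* The difference quotient is taken along s in I only: at t = 0 in [0, T)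
   this is the right derivative. *)
Definition has_deriv_within (R : realType) (d : nat) (I : set R)
    (x : R -> 'rV[R]_d) (t : R) (v : 'rV[R]_d) : Prop :=
  (s - t)^-1 *: (x s - x t) @[s --> within I t^'] --> v.

Definition C1_curve (R : realType) (d : nat) (I : set R)
    (x : R -> 'rV[R]_d) : Prop :=
  exists2 dx : R -> 'rV[R]_d,
    forall t, I t -> has_deriv_within I x t (dx t)
    & {within I, continuous dx}.

(* The values of x outside of [0, T) are irrelevant. *)
Definition NGD_solution (R : realType) (d : nat) (f : 'rV[R]_d -> R)
    (x0 : 'rV[R]_d) (T : \bar R) (x : R -> 'rV[R]_d) : Prop :=
  [/\ (0 < T)%E, x 0 = x0, C1_curve (time_interval T) x
    & forall t, time_interval T t ->
        grad f (x t) != 0 /\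
        has_deriv_within (time_interval T) x t
          (- ((enorm (grad f (x t)))^-1 *: grad f (x t)))].

Definition NGD_maximal_solution (R : realType) (d : nat) (f : 'rV[R]_d -> R)
    (x0 : 'rV[R]_d) (T : \bar R) (x : R -> 'rV[R]_d) : Prop :=
  NGD_solution f x0 T x /\
  ~ (exists (S : \bar R) (y : R -> 'rV[R]_d),
       [/\ (T < S)%E, NGD_solution f x0 S y
         & {in time_interval T, y =1 x}]).

Definition trajectory_orbit (R : realType) (d : nat) (T : \bar R) (x : R -> 'rV[R]_d)
    : set 'rV[R]_d :=
  [set x t | t in time_interval T].

(* Main.v *)
(* Put g(t) = f(x(t)) - f(xstar), so that g' = -|grad f(x(t))| < 0 along the
   whole trajectory.  Let m and L be the extreme absolute values of the
   eigenvalues of the Hessian; Taylor's formula gives, near xstar,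
     |f - f(xstar)| <= L |x - xstar|^2   and   m |f - f(xstar)| <= |grad f|^2.
   The increasing function -sgn(g) sqrt|g| has derivative
   |grad f| / (2 sqrt|g|), hence it grows at rate at least sqrt(m)/2 while the
   trajectory is in the ball, where its values stay in [- sqrt L r, sqrt L r].
   As it never decreases, also outside of the ball, the total time spent in
   the ball is at most 4 sqrt(L/m) r, however often the ball is re-entered. *)

Require Import Defs.
From mathcomp Require Import all_boot all_order all_algebra.
From mathcomp Require Import all_classical all_reals all_analysis.
From mathcomp Require Import measurable_realfun ring lra.
Import Order.TTheory GRing.Theory Num.Theory.
Import numFieldNormedType.Exports.
Local Open Scope classical_set_scope.
Local Open Scope ring_scope.

Set Implicit Arguments.
Unset Strict Implicit.
Unset Printing Implicit Defensive.

(** * Euclidean inner product and norm, and semidefinite forms *)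

Definition dot (R : realType) (d : nat) (u v : 'rV[R]_d) : R := (u *m v^T) 0 0.

Section LinearAlgebra.
Context {R : realType} {d : nat}.
Implicit Types (u v w : 'rV[R]_d) (A H : 'M[R]_d).

Lemma dotE u v : dot u v = \sum_i u 0 i * v 0 i.
Proof. by rewrite /dot mxE; apply: eq_bigr => i _; rewrite mxE. Qed.

Lemma dotC u v : dot u v = dot v u.
Proof. by rewrite !dotE; apply: eq_bigr => i _; rewrite mulrC. Qed.

Lemma dotDl u v w : dot (u + v) w = dot u w + dot v w.
Proof. by rewrite /dot mulmxDl mxE. Qed.

Lemma dotDr u v w : dot w (u + v) = dot w u + dot w v.
Proof. by rewrite dotC dotDl !(dotC w). Qed.

Lemma dotZl a u v : dot (a *: u) v = a * dot u v.
Proof. by rewrite /dot -scalemxAl mxE. Qed.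

Lemma dotZr a u v : dot u (a *: v) = a * dot u v.
Proof. by rewrite dotC dotZl dotC. Qed.

Lemma dotNl u v : dot (- u) v = - dot u v.
Proof. by rewrite -scaleN1r dotZl mulN1r. Qed.

Lemma dotNr u v : dot u (- v) = - dot u v.
Proof. by rewrite dotC dotNl dotC. Qed.

Lemma dot0l v : dot 0 v = 0.
Proof. by rewrite /dot mul0mx mxE. Qed.

Lemma dot_mulmxl A u v : dot (u *m A) v = dot u (v *m A^T).
Proof. by rewrite /dot trmx_mul trmxK mulmxA. Qed.

Lemma dotvv_ge0 u : 0 <= dot u u.
Proof. by rewrite dotE; apply: sumr_ge0 => i _; rewrite -expr2 sqr_ge0. Qed.

Lemma dotvv_eq0 u : dot u u = 0 -> u = 0.
Proof.
rewrite dotE => u0; apply/rowP => i; rewrite mxE.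
have := @psumr_eq0P R _ xpredT (fun i => u 0 i * u 0 i).
move=> /(_ _ u0 i isT) ui0; apply/eqP; rewrite -sqrf_eq0 expr2 ui0 //.
by move=> j _; rewrite -expr2 sqr_ge0.
Qed.

(** With [p], [q], [b] the values of the form at (u,u), (v,v), (u,v), its value at [q *: u - b *: v]
    is q (p q - b^2), which settles q > 0; p > 0 is symmetric. The case A = 1 is the usual
    inequality; degenerate forms serve to find kernels. *)
Lemma psd_cauchy_schwarz A : A^T = A -> (forall u, 0 <= dot (u *m A) u) ->
  forall u v, dot (u *m A) v ^+ 2 <= dot (u *m A) u * dot (v *m A) v.
Proof.
move=> symA psdA u v.
have symB x y : dot (x *m A) y = dot (y *m A) x by rewrite dot_mulmxl symA dotC.
have qE a b : dot ((a *: u + b *: v) *m A) (a *: u + b *: v) =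
    a ^+ 2 * dot (u *m A) u + 2 * a * b * dot (u *m A) v
    + b ^+ 2 * dot (v *m A) v.
  rewrite mulmxDl -!scalemxAl !dotDl !dotDr !dotZl !dotZr (symB v u); ring.
have := psdA u; have := psdA v.
set p := dot (u *m A) u; set q := dot (v *m A) v; set b := dot (u *m A) v.
move=> q0 p0.
have [q_gt0|] := ltP 0 q.
  have := psdA (q *: u + (- b) *: v); rewrite qE -/p -/q -/b.
  rewrite (_ : _ + _ = q * (p * q - b ^+ 2)); last by ring.
  by rewrite pmulr_rge0// subr_ge0.
have [p_gt0 _|] := ltP 0 p.
  have := psdA ((- b) *: u + p *: v); rewrite qE -/p -/q -/b.
  rewrite (_ : _ + _ = p * (p * q - b ^+ 2)); last by ring.
  by rewrite pmulr_rge0// subr_ge0.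
(* Here p = q = 0, and the value at u - b v is -2 b^2, so b = 0. *)
move=> p_le0 q_le0; have := psdA (1 *: u + (- b) *: v).
rewrite qE -/p -/q -/b.
have -> : p = 0 by apply/eqP; rewrite eq_le p_le0.
have -> : q = 0 by apply/eqP; rewrite eq_le q_le0.
have := sqr_ge0 b; nra.
Qed.

(** Cauchy-Schwarz for the form, applied to v and [v *m A], bounds the square of |v A|^2 by a
    multiple of the vanishing value at v. *)
Lemma psd_isotropic_ker A v : A^T = A -> (forall u, 0 <= dot (u *m A) u) ->
  dot (v *m A) v = 0 -> v *m A = 0.
Proof.
move=> symA psdA vAv; apply: dotvv_eq0; apply/eqP; rewrite -sqrf_eq0.
rewrite eq_le sqr_ge0 andbT.
by rewrite (le_trans (psd_cauchy_schwarz symA psdA _ _))// vAv mul0r.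
Qed.

Lemma enormE u : enorm u = Num.sqrt (dot u u).
Proof.
by rewrite /enorm dotE; congr Num.sqrt; apply: eq_bigr => i _; rewrite expr2.
Qed.

Lemma enorm_ge0 u : 0 <= enorm u.
Proof. exact: sqrtr_ge0. Qed.

Lemma sqr_enorm u : enorm u ^+ 2 = dot u u.
Proof. by rewrite enormE sqr_sqrtr// dotvv_ge0. Qed.

Lemma enorm_eq0 u : enorm u = 0 -> u = 0.
Proof. by move=> u0; apply: dotvv_eq0; rewrite -sqr_enorm u0 expr0n. Qed.

Lemma enorm0 : enorm (0 : 'rV[R]_d) = 0.
Proof. by rewrite enormE dot0l sqrtr0. Qed.

Lemma enorm_gt0 u : u != 0 -> 0 < enorm u.
Proof.
move=> u0; rewrite lt_def enorm_ge0 andbT.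
by apply: contra_neq u0 => /enorm_eq0.
Qed.

Lemma enormZ a u : enorm (a *: u) = `|a| * enorm u.
Proof.
by rewrite !enormE dotZl dotZr mulrA -expr2 sqrtrM ?sqr_ge0// sqrtr_sqr.
Qed.

Lemma enormN u : enorm (- u) = enorm u.
Proof. by rewrite -scaleN1r enormZ normrN1 mul1r. Qed.

Lemma cauchy_schwarz u v : `|dot u v| <= enorm u * enorm v.
Proof.
rewrite -ler_sqr ?nnegrE ?mulr_ge0 ?enorm_ge0// exprMn !sqr_enorm.
rewrite real_normK ?num_real//.
have := @psd_cauchy_schwarz 1%:M (trmx1 _ _) _ u v; rewrite !mulmx1; apply.
by move=> w; rewrite mulmx1 dotvv_ge0.
Qed.

Lemma enorm_triangle u v : enorm (u + v) <= enorm u + enorm v.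
Proof.
rewrite -ler_sqr ?nnegrE ?addr_ge0 ?enorm_ge0// sqrrD !sqr_enorm.
rewrite dotDl !dotDr (dotC v u).
have := ler_norm (dot u v); have := cauchy_schwarz u v.
rewrite mulr2n; lra.
Qed.

(** Factor H^2 - s^2 as (H + s)(H - s): either v (H + s) = 0 and v is an eigenvector for -s, or v (H
    + s) is an eigenvector for s. *)
Lemma eigenvalue_of_sqr H v s : 0 <= s -> v != 0 -> v *m H *m H = s ^+ 2 *: v ->
  exists2 l, eigenvalue H l & `|l| = s.
Proof.
move=> s0 v0 vHH; have [w0|w0] := eqVneq (v *m H + s *: v) 0.
  exists (- s); last by rewrite normrN ger0_norm.
  apply/eigenvalueP; exists v => //.
  by apply/eqP; rewrite scaleNr -addr_eq0 w0.
exists s; last by rewrite ger0_norm.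
apply/eigenvalueP; exists (v *m H + s *: v) => //.
by rewrite mulmxDl vHH -scalemxAl scalerDr scalerA -expr2 addrC.
Qed.

End LinearAlgebra.

(** * Comparison of the Euclidean norm with the sup norm, and compactness of the sphere *)

Section EuclideanTopology.
Context {R : realType} {d : nat}.
Implicit Types (u v : 'rV[R]_d) (A H : 'M[R]_d).

Lemma norm_le_enorm v : `|v| <= enorm v.
Proof.
rewrite [leLHS]/Num.norm /= mx_normrE; apply: bigmax_le => [|[i j] _ /=].
  exact: enorm_ge0.
rewrite -ler_sqr ?nnegrE ?enorm_ge0// sqr_enorm dotE real_normK ?num_real//.
rewrite (bigD1 j)//= (ord1 i) -expr2 lerDl sumr_ge0// => k _.
by rewrite -expr2 sqr_ge0.
Qed.

Lemma enorm_le_norm v : enorm v <= d%:R * `|v|.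
Proof.
have d0 : 0 <= d%:R * `|v| by rewrite mulr_ge0.
rewrite -ler_sqr ?nnegrE ?enorm_ge0// sqr_enorm dotE.
have -> : (d%:R * `|v|) ^+ 2 = \sum_(i < d) d%:R * `|v| ^+ 2.
  by rewrite sumr_const card_ord -[RHS]mulr_natl; ring.
apply: ler_sum => i _; have d1 : 1 <= d%:R :> R.
  by rewrite ler1n (leq_trans _ (ltn_ord i)).
rewrite -expr2 -real_normK ?num_real// (@le_trans _ _ (`|v| ^+ 2))//.
  rewrite ler_sqr ?nnegrE//.
  rewrite [leRHS]/Num.norm /= mx_normrE.
  by apply/bigmax_geP; right => /=; exists (0, i).
by rewrite ler_peMl// sqr_ge0.
Qed.

Lemma continuous_dot_mulmx A : continuous (fun v => dot (v *m A) v).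
Proof.
move=> v; apply: differentiable_continuous.
have -> : (fun v => dot (v *m A) v) =
    \sum_i (\sum_j (fun w : 'rV[R]_d => w 0 j * A j i)) * (fun w => w 0 i).
  apply/funext => w; rewrite dotE fct_sumE; apply: eq_bigr => i _.
  by rewrite mxE -[(_ * _) w]/(_ w * _) fct_sumE.
apply: differentiable_sum => i; apply: differentiableM.
  apply: differentiable_sum => j; apply: differentiableM => //.
  exact: differentiable_coord.
exact: differentiable_coord.
Qed.

Lemma continuous_enorm : continuous (@enorm R d).
Proof.
have -> : @enorm R d = Num.sqrt \o (fun v => dot (v *m 1%:M) v).
  by apply/funext => v /=; rewrite enormE mulmx1.
move=> v; apply: continuous_comp; first exact: continuous_dot_mulmx.
exact: sqrt_continuous.
Qed.

(** Sup-norm neighbourhoods contain Euclidean balls, the sup norm being the smaller one; this turns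
    library limits into Euclidean radii. *)
Lemma near_enorm v (P : set 'rV[R]_d) : (\forall u \near v, P u) ->
  exists2 e, 0 < e & forall u, enorm (u - v) < e -> P u.
Proof.
move=> /nbhs_ballP[e /= e0 eP]; exists e => // u uve; apply: eP.
by rewrite -ball_normE /= distrC (le_lt_trans (norm_le_enorm _)).
Qed.

Lemma compact_sphere : compact [set v : 'rV[R]_d | enorm v = 1].
Proof.
apply: bounded_closed_compact.
  exists 1; split; first exact: num_real.
  move=> M M1 v /= v1; rewrite (le_trans (norm_le_enorm _))// v1; exact: ltW.
rewrite -[X in closed X]/(@enorm R d @^-1` [set x | x = 1]).
apply: preimage_closed; last exact: closed_eq.
by move=> v _; exact: continuous_enorm.
Qed.

End EuclideanTopology.

(** * Extreme absolute eigenvalues of a symmetric matrix, by extremizing on the sphere *)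

Section SpectralBounds.
Context {R : realType} {d : nat}.
Variable H : 'M[R]_d.
Hypotheses (d_gt0 : (0 < d)%N) (H_sym : H^T = H).
Implicit Types u v : 'rV[R]_d.

(** The form of H^2 is used instead of that of H because its extrema on the unit sphere are the
    squares of the extreme absolute eigenvalues. *)
Let q v := dot (v *m (H *m H)) v.

Let qE v : q v = enorm (v *m H) ^+ 2.
Proof. by rewrite /q mulmxA dot_mulmxl H_sym sqr_enorm. Qed.

Let q_ge0 v : 0 <= q v. Proof. by rewrite qE sqr_ge0. Qed.

Let sphere_neq0 : [set v : 'rV[R]_d | enorm v = 1] !=set0.
Proof.
have v0 : const_mx 1 != 0 :> 'rV[R]_d.
  apply/eqP => /rowP/(_ (Ordinal d_gt0)); rewrite !mxE => /eqP.
  by rewrite oner_eq0.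
exists ((enorm (const_mx 1 : 'rV[R]_d))^-1 *: const_mx 1) => /=.
by rewrite enormZ ger0_norm ?invr_ge0 ?enorm_ge0// mulVf// gt_eqF// enorm_gt0.
Qed.

Let q_homogeneous v : v != 0 ->
  q v = enorm v ^+ 2 * q ((enorm v)^-1 *: v).
Proof.
move=> v0; rewrite !qE -scalemxAl enormZ exprMn normfV ger0_norm ?enorm_ge0//.
by rewrite exprVn mulrA mulfV ?mul1r// sqrf_eq0 gt_eqF// enorm_gt0.
Qed.

Let unit_normalized v : v != 0 -> enorm ((enorm v)^-1 *: v) = 1.
Proof.
move=> v0.
by rewrite enormZ ger0_norm ?invr_ge0 ?enorm_ge0// mulVf// gt_eqF// enorm_gt0.
Qed.

(** The sign treats maxima ([b = false]) and minima ([b = true]) at once. An extremal v satisfies v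
    H^2 = q(v) v, and [eigenvalue_of_sqr] then yields an eigenvalue of H itself. *)
Let eigenvalue_extremal (b : bool) v : enorm v = 1 ->
  (forall u, enorm u = 1 -> 0 <= (-1) ^+ b * (q v - q u)) ->
  exists2 l, eigenvalue H l & `|l| ^+ 2 = q v.
Proof.
move=> v1 extv.
have v0 : v != 0.
  by apply/eqP => v0; move/eqP: v1; rewrite v0 enorm0 eq_sym oner_eq0.
(* A is positive semidefinite with v isotropic, so v is in its kernel. *)
pose A := (-1) ^+ b *: ((q v)%:M - H *m H).
have AE u : dot (u *m A) u = (-1) ^+ b * (q v * enorm u ^+ 2 - q u).
  rewrite -scalemxAr dotZl mulmxBr dotDl dotNl mul_mx_scalar dotZl.
  by rewrite sqr_enorm.
have vA : v *m A = 0.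
  apply: psd_isotropic_ker; last 1 first.
  - by rewrite AE v1 expr1n mulr1 subrr mulr0.
  - by rewrite /A linearZ /= linearB /= tr_scalar_mx trmx_mul H_sym.
  move=> u; rewrite AE; have [->|u0] := eqVneq u 0.
    by rewrite enorm0 /q mul0mx dot0l expr0n/= mulr0 subrr mulr0.
  rewrite (q_homogeneous u0) (mulrC (q v)) -mulrBr mulrCA mulr_ge0 ?sqr_ge0//.
  exact/extv/unit_normalized.
have : v *m H *m H = Num.sqrt (q v) ^+ 2 *: v.
  rewrite sqr_sqrtr// -mulmxA; apply/esym/eqP; rewrite -subr_eq0.
  move/eqP: vA; rewrite /A -scalemxAr scaler_eq0 signr_eq0/= mulmxBr.
  by rewrite mul_mx_scalar.
move=> /(eigenvalue_of_sqr (sqrtr_ge0 _) v0)[l Hl lE].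
by exists l => //; rewrite lE sqr_sqrtr.
Qed.

Let bound_of_eigen (l : R) (b : bool) v :
  `|l| ^+ 2 = q v ->
  (forall u, enorm u = 1 -> 0 <= (-1) ^+ b * (q v - q u)) ->
  forall u, 0 <= (-1) ^+ b * (`|l| * enorm u - enorm (u *m H)).
Proof.
move=> lv extv u; have [->|u0] := eqVneq u 0.
  by rewrite mul0mx enorm0 mulr0 subrr mulr0.
have ext_u : 0 <= (-1) ^+ b * ((enorm u * `|l|) ^+ 2 - enorm (u *m H) ^+ 2).
  rewrite -qE (q_homogeneous u0) exprMn lv -mulrBr mulrCA mulr_ge0 ?sqr_ge0//.
  exact/extv/unit_normalized.
move: ext_u.
have lu : 0 <= enorm u * `|l| by rewrite mulr_ge0 ?enorm_ge0.
have := enorm_ge0 (u *m H); rewrite (mulrC `|l|); move: lu.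
set x := enorm u * _; set y := enorm _; case: b {extv} => x0 y0.
  by rewrite !expr1 !mulN1r !oppr_ge0 !subr_le0 ler_sqr.
by rewrite !expr0 !mul1r !subr_ge0 ler_sqr.
Qed.

Lemma spectral_upper_bound : exists2 l, eigenvalue H l &
  forall u, enorm (u *m H) <= `|l| * enorm u.
Proof.
have [v vS vmax] := EVT_max_rV sphere_neq0 compact_sphere
  (continuous_subspaceT (@continuous_dot_mulmx R d (H *m H))).
have ext u : enorm u = 1 -> 0 <= (-1) ^+ false * (q v - q u).
  by move=> u1; rewrite expr0 mul1r subr_ge0; apply: vmax; rewrite inE.
rewrite inE in vS; have [l Hl lv] := eigenvalue_extremal vS ext.
exists l => // u; have := bound_of_eigen lv ext u.
by rewrite expr0 mul1r subr_ge0.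
Qed.

Lemma spectral_lower_bound : exists2 l, eigenvalue H l &
  forall u, `|l| * enorm u <= enorm (u *m H).
Proof.
have [v vS vmax] := EVT_min_rV sphere_neq0 compact_sphere
  (continuous_subspaceT (@continuous_dot_mulmx R d (H *m H))).
have ext u : enorm u = 1 -> 0 <= (-1) ^+ true * (q v - q u).
  move=> u1; rewrite expr1 mulN1r oppr_ge0 subr_le0.
  by apply: vmax; rewrite inE.
rewrite inE in vS; have [l Hl lv] := eigenvalue_extremal vS ext.
exists l => // u; have := bound_of_eigen lv ext u.
by rewrite expr1 mulN1r oppr_ge0 subr_le0.
Qed.

Lemma condition_number_bounds : H \in unitmx ->
  exists m L, [/\ 0 < m <= L, condition_number H = L / m,
    forall u, m * enorm u <= enorm (u *m H) &
    forall u, enorm (u *m H) <= L * enorm u].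
Proof.
move=> Hu; have [m Hm mP] := spectral_lower_bound.
have [L HL LP] := spectral_upper_bound.
(* An eigenvector for 0 would be killed by the invertible H. *)
have neq0 l : eigenvalue H l -> 0 < `|l|.
  move=> /eigenvalueP[v vH v0]; rewrite normr_gt0; apply/eqP => l0.
  move: vH; rewrite l0 scale0r => vH0; move/eqP: v0; apply.
  by rewrite -(mulmxK Hu v) vH0 mul0mx.
(* Testing both bounds on an eigenvector, where |v H| = |l| |v|, shows that [|m|] and [|L|] are the
   least and the greatest absolute eigenvalue, hence the inf and the sup. *)
have eigP l : eigenvalue H l -> `|m| <= `|l| <= `|L|.
  move=> /eigenvalueP[v vH v0]; have v_gt0 := enorm_gt0 v0.
  have := mP v; have := LP v; rewrite vH enormZ !ler_pM2r// => -> ->//.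
exists `|m|, `|L|; split=> //.
  by rewrite neq0//; have /andP[] := eigP _ Hm.
rewrite /condition_number; congr (_ / _); apply/eqP; rewrite eq_le.
  apply/andP; split.
    apply: ge_sup; first by exists `|L|, L.
    by move=> _ [l Hl <-]; have /andP[] := eigP _ Hl.
  apply: ub_le_sup; last by exists L.
  by exists `|L| => _ [l Hl <-]; have /andP[] := eigP _ Hl.
apply/andP; split.
  apply: ge_inf; last by exists m.
  by exists `|m| => _ [l Hl <-]; have /andP[] := eigP _ Hl.
apply: lb_le_inf; first by exists `|m|, m.
by move=> _ [l Hl <-]; have /andP[] := eigP _ Hl.
Qed.

End SpectralBounds.

(** * Taylor expansions, symmetry of the Hessian, and estimates at a critical point *)

Section SecondOrder.
Context {R : realType} {d : nat}.
Variable f : 'rV[R]_d -> R.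
Implicit Types u v w x : 'rV[R]_d.

Lemma diff_grad x v : differentiable f x -> 'd f x v = dot (grad f x) v.
Proof.
move=> fx; rewrite [v in LHS]row_sum_delta linear_sum dotE.
by apply: eq_bigr => i _; rewrite linearZ /= mxE deriveE// mulrC.
Qed.

Lemma is_derive_along_curve (c : R -> 'rV[R]_d) (t : R) v :
  differentiable f (c t) -> is_derive t 1 c v ->
  is_derive t 1 (f \o c) (dot (grad f (c t)) v).
Proof.
move=> fct dc; have ct : differentiable c t by exact/derivable1_diffP.
have fc : differentiable (f \o c) t by exact: differentiable_comp.
split; first exact/derivable1_diffP.
by rewrite deriveE// diff_comp//= -(deriveE _ ct) derive_val diff_grad.
Qed.

Lemma is_derive_line x v (t : R) : is_derive t 1 (fun s => x + s *: v) v.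
Proof.
have dZ : is_derive t 1 (fun s : R => s *: v) v.
  have ds : is_diff t ( *:%R^~ v) ( *:%R^~ v) by exact: is_diff_scalel.
  split; first by apply/derivable1_diffP; exact: ex_diff.
  by rewrite deriveE ?diff_val ?scale1r//; exact: ex_diff.
have := @is_deriveD _ _ _ (cst x) (fun s : R => s *: v) t 1 0 v _ dZ.
by rewrite add0r; exact.
Qed.

Lemma grad_expansion x (e : R) : differentiable (grad f) x -> 0 < e ->
  exists2 r, 0 < r & forall w, enorm w < r ->
    enorm (grad f (x + w) - grad f x - w *m hessian f x) <= e * enorm w.
Proof.
(* Passing from the Euclidean to the sup norm costs a factor d, absorbed by d + 1, which is positive
   even for d = 0. *)
move=> fx e0; have e'0 : 0 < e / d.+1%:R by rewrite divr_gt0.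
have /near_enorm[r r0 rP] : \forall w \near (0 : 'rV[R]_d),
    `|grad f (x + w) - grad f x - w *m hessian f x| <= e / d.+1%:R * `|w|.
  have /eqaddoP fxo := diff_locally fx.
  apply: filterS (fxo _ e'0) => w /=.
  rewrite !fctE /hessian /jacobian mul_rV_lin1 /=.
  by rewrite (addrC x) opprD addrA.
exists r => // w wr; have := rP w; rewrite subr0 => /(_ wr) wP.
rewrite (le_trans (enorm_le_norm _))//.
rewrite (le_trans (ler_wpM2l _ wP))// mulrCA mulrA -mulrA mulrAC.
have dd : 0 < d.+1%:R :> R by [].
rewrite [leLHS](_ : _ = (d%:R / d.+1%:R) * (e * `|w|)); last first.
  by field; rewrite gt_eqF.
rewrite (@le_trans _ _ (1 * (e * `|w|)))//.
  apply: ler_wpM2r; first by rewrite mulr_ge0// ltW.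
  by rewrite ler_pdivrMr// mul1r ler_nat.
by rewrite mul1r ler_wpM2l ?norm_le_enorm ?ltW.
Qed.

Hypothesis df : forall x, differentiable f x.

(** Subtract the quadratic model from f along s -> x + u + s v: the derivative in s is the
    first-order remainder of the gradient at u + s v, paired with v, and the mean value theorem on
    [0, 1] concludes. The shift u serves the symmetry of the Hessian; u = 0 is the usual Taylor
    formula. *)
Lemma second_order_expansion x (e : R) : differentiable (grad f) x -> 0 < e ->
  exists2 r, 0 < r & forall u v, enorm u < r -> enorm v < r ->
    `|f (x + u + v) - f (x + u) - dot (grad f x) v
      - dot (u *m hessian f x) v - 2^-1 * dot (v *m hessian f x) v|
    <= e * (enorm u + enorm v) * enorm v.
Proof.
move=> fx e0; have [r r0 rP] := grad_expansion fx e0.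
(* Halving the radius keeps u + c v within r for 0 < c < 1. *)
exists (r / 2); first by rewrite divr_gt0.
move=> u v ur vr; set H := hessian f x in rP *.
pose k := dot (grad f x) v + dot (u *m H) v.
pose q := 2^-1 * dot (v *m H) v.
pose phi (s : R) := f (x + u + s *: v) - s * k - s ^+ 2 * q.
pose dphi (s : R) := dot (grad f (x + (u + s *: v)) - grad f x
  - (u + s *: v) *m H) v.
have dphiP (s : R) : is_derive s 1 phi (dphi s).
  have h1 := is_derive_along_curve (df _) (is_derive_line (x + u) v s).
  rewrite /phi; apply: is_derive_eq.
  rewrite !scaler0 -[k%:A]/(k * 1) -[q *: _]/(q * _) -[s%:A]/(s * 1).
  rewrite /dphi mulmxDl !dotDl !dotNl dotDl -scalemxAl dotZl /k /q addrA.
  by field.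
have [|c /[!in_itv]/= /andP[c0 c1]] := MVT ltr01 (fun s _ => dphiP s).
  apply: continuous_subspaceT => s.
  by apply: differentiable_continuous; apply/derivable1_diffP.
rewrite subr0 mulr1 => phi10.
have -> : f (x + u + v) - f (x + u) - dot (grad f x) v
      - dot (u *m H) v - 2^-1 * dot (v *m H) v = dphi c.
  by rewrite -phi10 /phi scale1r scale0r addr0 /k /q; ring.
have uv : enorm (u + c *: v) <= enorm u + enorm v.
  rewrite (le_trans (enorm_triangle _ _))// lerD2l enormZ gtr0_norm//.
  by rewrite ler_piMl ?enorm_ge0// ltW.
rewrite /dphi (le_trans (cauchy_schwarz _ _))// ler_wpM2r ?enorm_ge0//.
rewrite (le_trans (rP _ _))//; last by rewrite ler_wpM2l// ltW.
by rewrite (le_lt_trans uv)//; lra.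
Qed.

(* Both orders of adding u and v lead from f x to f (x + u + v); comparing the
   two second order expansions at scale t leaves t^2 (uHv - vHu) = o(t^2). *)
Lemma hessian_bilin_sym x u v : differentiable (grad f) x ->
  dot (u *m hessian f x) v = dot (v *m hessian f x) u.
Proof.
move=> fx; set H := hessian f x.
set B := dot (u *m H) v - dot (v *m H) u.
suff : B = 0 by move/eqP; rewrite subr_eq0 => /eqP.
pose c := 1 + enorm u + enorm v.
have [u0 v0] := (enorm_ge0 u, enorm_ge0 v).
have c1 : 1 <= c by rewrite /c; lra.
have Bc e : 0 < e -> `|B| <= e * (4 * c ^+ 2).
  move=> e0; have [r r0 rP] := second_order_expansion fx e0.
  (* [c] dominates both norms, so at this scale t u and t v have norm at most r / 2. *)
  pose t := r / c / 2; have c0 : 0 < c by lra.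
  have t0 : 0 < t by rewrite !divr_gt0.
  have tr w : enorm w <= c -> enorm (t *: w) < r.
    move=> wc; rewrite enormZ gtr0_norm//.
    rewrite (@le_lt_trans _ _ (t * c)) ?ler_pM2l// /t.
    rewrite (_ : _ * c = r / 2); last by field; rewrite gt_eqF.
    by lra.
  have tu : enorm (t *: u) < r by apply: tr; rewrite /c; lra.
  have tv : enorm (t *: v) < r by apply: tr; rewrite /c; lra.
  have t00 : enorm (0 : 'rV[R]_d) < r by rewrite enorm0.
  have := rP _ _ tu tv; have := rP _ _ tv tu.
  have := rP _ _ t00 tv; have := rP _ _ t00 tu.
  rewrite !mul0mx !dot0l !enorm0 !enormZ (gtr0_norm t0) !addr0 !add0r.
  rewrite !subr0 -!scalemxAl !dotZl !dotZr -/H.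
  rewrite (_ : x + t *: v + t *: u = x + t *: u + t *: v); last first.
    by rewrite addrAC.
  rewrite /B.
  move: (dot (u *m H) v) (dot (v *m H) u) (dot (u *m H) u) (dot (v *m H) v).
  move: (f _) (f _) (f _) (f _) (dot _ u) (dot _ v) => f1 f2 f3 f4 g1 g2.
  move=> b1 b2 b3 b4.
  rewrite !ler_norml => /andP[h1 h2] /andP[h3 h4] /andP[h5 h6] /andP[h7 h8].
  have t2 : 0 < t ^+ 2 by rewrite exprn_gt0.
  (* The left side, times e t^2, is the sum of the four error terms. *)
  have uvc : enorm u ^+ 2 + enorm v ^+ 2 + (enorm u + enorm v) ^+ 2
      <= 4 * c ^+ 2 by rewrite /c; nra.
  have {}uvc : e * t ^+ 2 * (enorm u ^+ 2 + enorm v ^+ 2 +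
      (enorm u + enorm v) ^+ 2) <= e * t ^+ 2 * (4 * c ^+ 2).
    by apply: ler_wpM2l => //; exact/ltW/mulr_gt0.
  apply/andP; split.
    by rewrite -(ler_pM2l t2); lra.
  by rewrite -(ler_pM2l t2); lra.
apply/eqP; rewrite -normr_eq0; apply/negPn/negP => B0.
have {}B0 : 0 < `|B| by rewrite lt_def normr_ge0 B0.
have c0 : 0 < 4 * c ^+ 2 by rewrite mulr_gt0// exprn_gt0//; lra.
(* This choice of e gives |B| <= |B| / 2, contradicting B != 0. *)
have := Bc (`|B| / (4 * c ^+ 2) / 2).
rewrite (_ : _ / _ / _ * _ = `|B| / 2); last by field; rewrite gt_eqF//; lra.
have -> : 0 < `|B| / (4 * c ^+ 2) / 2 by rewrite !divr_gt0.
by move=> /(_ isT); lra.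
Qed.

Lemma hessian_sym x : differentiable (grad f) x ->
  (hessian f x)^T = hessian f x.
Proof.
move=> fx; apply/matrixP => i j; rewrite mxE.
have entry (k l : 'I_d) :
    hessian f x k l = dot (delta_mx 0 k *m hessian f x) (delta_mx 0 l).
  rewrite dotE -rowE (bigD1 l)//= !mxE !eqxx mulr1 big1 ?addr0// => n nl.
  by rewrite !mxE (negbTE nl) andbF mulr0.
by rewrite !entry hessian_bilin_sym.
Qed.

(** Write n = |w|, h = |w H| and F = f(x + w) - f(x). With relative error m / 8 in both expansions,
    |F| <= n h / 2 + m n^2 / 8 and |grad f(x + w)| >= 7 h / 8. As m n <= h <= L n, this yields |F|
    <= (5/8) L n^2 and m |F| <= (5/8) h^2, and 5/8 is below (7/8)^2 = 49/64. *)
Lemma nondegenerate_critical_bounds x (m L : R) :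
  differentiable (grad f) x -> grad f x = 0 -> 0 < m <= L ->
  (forall w, m * enorm w <= enorm (w *m hessian f x) <= L * enorm w) ->
  exists2 r, 0 < r & forall w, enorm w < r ->
    `|f (x + w) - f x| <= L * enorm w ^+ 2 /\
    m * `|f (x + w) - f x| <= enorm (grad f (x + w)) ^+ 2.
Proof.
move=> fx gx /andP[m0 mL] HP; have e0 : 0 < m / 8 by rewrite divr_gt0.
have [r1 r10 r1P] := grad_expansion fx e0.
have [r2 r20 r2P] := second_order_expansion fx e0.
exists (Num.min r1 r2); first by rewrite lt_min r10.
move=> w; rewrite lt_min => /andP[/r1P + wr2].
have : enorm (0 : 'rV[R]_d) < r2 by rewrite enorm0.
move=> /r2P/(_ wr2).
rewrite gx !subr0 mul0mx !dot0l addr0 !subr0 enorm0 add0r.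
have := HP w; have := cauchy_schwarz (w *m hessian f x) w.
have := enorm_triangle (grad f (x + w)) (w *m hessian f x - grad f (x + w)).
rewrite addrCA subrr addr0 -(enormN (_ - grad f _)) opprB.
have := enorm_ge0 w.
move: (enorm w) (enorm (w *m _)) (enorm (_ - _)) (enorm (grad _ _)) (dot _ _).
move: (f _ - f _) => F n h g0 g b n0 tri cs /andP[mh hL] F8 g8.
have {}F8 : `|F| <= n * h / 2 + m / 8 * n ^+ 2.
  rewrite -(subrK (2^-1 * b) F) (le_trans (ler_normD _ _))// normrM.
  by rewrite (@ger0_norm _ 2^-1)// expr2 mulrA; lra.
have h0 : 0 <= h by rewrite (le_trans _ mh)// mulr_ge0// ltW.
have hg : 7 / 8 * h <= g by lra.
have nh : n * h <= L * n ^+ 2 by rewrite expr2 mulrCA ler_wpM2l.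
have mn2 : m * n ^+ 2 <= L * n ^+ 2 by rewrite ler_wpM2r// sqr_ge0.
have nh0 : 0 <= n * h by rewrite mulr_ge0.
split; first by lra.
have mnh : m * n * h <= h ^+ 2 by rewrite expr2 ler_wpM2r.
have mn2h : (m * n) ^+ 2 <= h ^+ 2.
  by rewrite ler_sqr ?nnegrE// mulr_ge0// ltW.
have mF : m * `|F| <= m * (n * h / 2 + m / 8 * n ^+ 2) by rewrite ler_pM2l.
have g2 : (7 / 8 * h) ^+ 2 <= g ^+ 2 by rewrite ler_sqr ?nnegrE//; lra.
have := sqr_ge0 h; rewrite exprMn in mn2h; lra.
Qed.

End SecondOrder.

(** * Measure of a set on which a nondecreasing function grows at a definite rate *)

Lemma measure_le_of_derive_ge (R : realType) (E I : set R) (h dh : R -> R)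
    (c A : R) :
  measurable E -> E `<=` I -> is_interval I -> 0 < c -> 0 <= A ->
  (forall t, I t -> is_derive t 1 h (dh t)) ->
  (forall t, I t -> {for t, continuous dh}) ->
  (forall t, I t -> 0 <= dh t) -> (forall t, E t -> c <= dh t) ->
  (forall a b, E a -> E b -> h b - h a <= A) ->
  (lebesgue_measure E <= (A / c)%:E)%E.
Proof.
move=> mE EI intI c0 A0 hI dhI dh0 cdh hA.
(* Inner regularity reduces the claim to compact K inside E. The least and greatest points a, b of K
   lie in E, so the increment of h over [a, b] is at most A, while [a, b] stays inside the interval
   I. *)
rewrite lebesgue_regularity_inner_sup//; apply: ge_ereal_sup.
move=> _ [K [cK KE] <-].
have Ac0 : 0 <= A / c by rewrite divr_ge0// ltW.
have [->|K0] := eqVneq K set0; first by rewrite measure0 lee_fin.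
move/set0P in K0.
have cid : {within K, continuous (@idfun R)}.
  by apply: continuous_subspaceT => t; exact: cvg_id.
have [a /set_mem Ka amin] := compact_EVT_min K0 cK cid.
have [b /set_mem Kb bmax] := compact_EVT_max K0 cK cid.
have Kab : K `<=` `[a, b].
  by move=> t /mem_set Kt /=; rewrite in_itv /= amin// bmax.
have mK : measurable K by exact: compact_measurable.
have [ab|ba] := ltP a b; last first.
  rewrite (@le_trans _ _ (lebesgue_measure `[a, b]))//.
    by apply: le_measure; rewrite ?inE.
  by rewrite lebesgue_measure_itv /= lte_fin ltNge ba /= lee_fin.
have abI t : t \in `[a, b] -> I t.
  rewrite in_itv /= => tab; apply: intI tab; exact/EI/KE.
have cdhab : {within `[a, b], continuous dh}.
  apply: continuous_in_subspaceT => t; rewrite inE => tab.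
  exact/dhI/abI.
have ch t : t \in `[a, b] -> {for t, continuous h}.
  move=> /abI/hI ht; apply: differentiable_continuous.
  exact/derivable1_diffP.
have ftc := @continuous_FTC2 R dh h a b ab cdhab.
have {}ftc : (\int[lebesgue_measure]_(x in `[a, b]) (dh x)%:E =
    (h b)%:E - (h a)%:E)%E.
  apply: ftc.
    split.
    - by move=> t tab; have /abI/hI[] := subset_itv_oo_cc tab.
    - by apply: cvg_at_right_filter; apply: ch; rewrite in_itv/= lexx ltW.
    - by apply: cvg_at_left_filter; apply: ch; rewrite in_itv/= lexx ltW.
  move=> t tab; rewrite derive1E.
  by have /abI/hI ht := subset_itv_oo_cc tab; rewrite derive_val.
have mdh : measurable_fun `[a, b] (EFin \o dh).
  apply/measurable_EFinP; apply: subspace_continuous_measurable_fun => //.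
(* The chain is: c times the measure of K <= integral of [dh] over K <= integral over [a, b] = h b -
   h a <= A. The gaps of K only add, since [dh] is nonnegative on I. *)
rewrite EFinM lee_pdivlMr// muleC -integral_cst//.
apply: (@le_trans _ _ (\int[lebesgue_measure]_(x in K) (dh x)%:E)%E).
  apply: ge0_le_integral => //.
  - by move=> t Kt; rewrite lee_fin ltW.
  - exact: measurable_funS mdh.
  - by move=> t Kt; rewrite lee_fin; exact/cdh/KE.
apply: (@le_trans _ _ (\int[lebesgue_measure]_(x in `[a, b]) (dh x)%:E)%E).
  apply: ge0_subset_integral => // t tab.
  by rewrite lee_fin; exact/dh0/abI.
by rewrite ftc -EFinB lee_fin; apply: hA; exact: KE.
Qed.

(** * Time spent in an open set S by a flow with g' = -n, n > 0 and m |g| <= n^2 on S *)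

Section Sojourn.
Context {R : realType}.
Variables (J S : set R) (g n : R -> R) (m A : R).
Hypotheses (J_itv : is_interval J) (S_open : open S) (SJ : S `<=` J).
Hypothesis dg : forall t, J t -> is_derive t 1 g (- n t).
Hypothesis n_cont : forall t, J t -> {for t, continuous n}.
Hypothesis n_gt0 : forall t, J t -> 0 < n t.
Hypotheses (m_gt0 : 0 < m) (A_ge0 : 0 <= A).
Hypothesis gA : forall t, S t -> `|g t| <= A ^+ 2.
Hypothesis mg : forall t, S t -> m * `|g t| <= n t ^+ 2.

Let g_cont t : J t -> {for t, continuous g}.
Proof.
by move=> /dg ?; apply: differentiable_continuous; exact/derivable1_diffP.
Qed.

Let g_decr a b : J a -> J b -> a < b -> g b < g a.
Proof.
move=> Ja Jb ab.
have abJ t : a <= t <= b -> J t by exact: J_itv.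
have [||c /[!in_itv]/= /andP[ac cb] E] := @MVT R g (- n) a b ab.
- by move=> t /[!in_itv]/= /andP[/ltW ? /ltW ?]; exact/dg/abJ/andP.
- apply: continuous_in_subspaceT => t; rewrite inE/= in_itv/= => tab.
  exact/g_cont/abJ.
rewrite -subr_lt0 E -[(- n) c]/(- n c) mulNr oppr_lt0 mulr_gt0 ?subr_gt0//.
by apply/n_gt0/abJ; rewrite !ltW.
Qed.

(** The sign of g is fixed (positive for [b = false], negative for [b = true]) because the square
    root of |g| need not be differentiable where g vanishes. *)
Let signed_part (b : bool) := S `&` [set t | 0 < (-1) ^+ b * g t].

Let signed_part_open b : open (signed_part b).
Proof.
rewrite openE => t [St gt].
apply: filterI; first exact: open_nbhs_nbhs.
have : {for t, continuous (fun s => (-1) ^+ b * g s)}.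
  by apply: continuousM; [exact: cst_continuous|exact/g_cont/SJ].
by move=> /(_ _ (lt_nbhsr gt)).
Qed.

Let measure_signed_part b :
  (lebesgue_measure (signed_part b) <= (A / (Num.sqrt m / 2))%:E)%E.
Proof.
set s : R := (-1) ^+ b.
have ss : s * s = 1 by rewrite /s -expr2 sqrr_sign.
have s1 : s = 1 \/ s = -1 by rewrite /s; case: (b); [right|left].
(* As s^2 = 1, h' = n / (2 sqrt(s g)) for either sign: positive on J, and at least sqrt(m) / 2 on
   S. *)
pose h t := - s * Num.sqrt (s * g t).
pose dh t := n t / (2 * Num.sqrt (s * g t)).
(* The growth interval is not cut down to S, so h keeps increasing between visits to S. *)
apply: (@measure_le_of_derive_ge _ _
  (J `&` [set t | 0 < s * g t]) h dh) => //.
- by apply: open_measurable; exact: (@signed_part_open b).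
- by move=> t [/SJ ? ?].
(* Since g decreases, g > 0 holds on an initial piece of J and g < 0 on a final one. *)
- move=> u v [Ju gu] [Jv gv] t /andP[ut tv].
  have Jt : J t by apply: (J_itv Ju Jv); rewrite ut.
  split => //=; move: gu gv => /=; case: s1 => ->.
    rewrite !mul1r => gu gv; move: tv; rewrite le_eqVlt => /predU1P[->//|tv].
    exact/(lt_trans gv)/g_decr.
  rewrite !mulN1r !oppr_gt0 => gu gv.
  move: ut; rewrite le_eqVlt => /predU1P[<-//|ut].
  by rewrite (lt_trans _ gu)//; exact: g_decr.
- by rewrite divr_gt0// sqrtr_gt0.
- move=> t [Jt /= gt].
  have dsg : is_derive t 1 (fun t => s * g t) (s * - n t).
    have := dg Jt => dgt.
    by have := @is_deriveZ _ _ _ g s t 1 _ dgt.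
  have dsq := @is_derive1_comp _ Num.sqrt (fun t => s * g t) t _ _
    (is_derive1_sqrt gt) dsg.
  have := @is_deriveZ _ _ _ _ (- s) t 1 _ dsq.
  rewrite -[_ *: (_ * _)]/(- s * (_ * _)) /dh.
  rewrite (_ : - s * _ = s * s * (n t / (2 * Num.sqrt (s * g t)))); last first.
    by ring.
  by rewrite ss mul1r.
- move=> t [Jt /= gt]; apply: continuousM; first exact: n_cont.
  apply: continuousV.
    by rewrite mulf_neq0// gt_eqF// sqrtr_gt0.
  apply: continuousM; first exact: cst_continuous.
  apply: continuous_comp; last exact: sqrt_continuous.
  by apply: continuousM; [exact: cst_continuous|exact: g_cont].
- move=> t [Jt /= gt]; rewrite divr_ge0 ?ltW ?n_gt0//.
  by rewrite mulr_gt0// sqrtr_gt0.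
- move=> t [St]; rewrite /= -/s => gt.
  have abs_g : `|g t| = s * g t.
    rewrite -[in RHS](ger0_norm (ltW gt)) normrM.
    by case: s1 => ->; rewrite ?normrN normr1 mul1r.
  rewrite /dh ler_pdivlMr ?mulr_gt0 ?sqrtr_gt0//.
  rewrite [leLHS](_ : _ = Num.sqrt m * Num.sqrt (s * g t)); last by field.
  rewrite -(sqrtrM _ (ltW m_gt0)) -abs_g -(ger0_norm (ltW (n_gt0 (SJ St)))).
  by rewrite -(sqrtr_sqr (n t)) ler_wsqrtr// mg.
(* On S the values of h fill at most [-A, 0] or [0, A], according to the sign. *)
- move=> u v [Su] + [Sv]; rewrite /= -/s => gu gv.
  have sqA t : S t -> 0 < s * g t -> 0 <= Num.sqrt (s * g t) <= A.
    move=> St gt; rewrite sqrtr_ge0/= -(ger0_norm A_ge0).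
    rewrite -(sqrtr_sqr A).
    rewrite ler_wsqrtr// (le_trans (ler_norm _))// normrM.
    by case: s1 => ->; rewrite ?normrN normr1 mul1r gA.
  have /andP[u0 uA] := sqA _ Su gu; have /andP[v0 vA] := sqA _ Sv gv.
  by move: u0 uA v0 vA; rewrite /h; case: s1 => ->; lra.
Qed.

(** Each sign of g contributes at most 2 A / sqrt(m), and g, being strictly decreasing, vanishes at
    most once. *)
Lemma sojourn_measure_le : (lebesgue_measure S <= (4 * A / Num.sqrt m)%:E)%E.
Proof.
pose Z := S `&` [set t | g t = 0].
have mP b : measurable (signed_part b).
  by apply: open_measurable; exact: (@signed_part_open b).
have [t0 Zt0] : exists t0, Z `<=` [set t0].
  have [Z0|/set0P[t [St gt]]] := eqVneq Z set0.
    by exists 0; rewrite Z0; exact: sub0set.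
  exists t => u [Su gu] /=; apply/eqP; rewrite eq_le !leNgt.
  apply/andP; split; apply/negP => tu.
    by have := g_decr (SJ St) (SJ Su) tu; rewrite gt gu ltxx.
  by have := g_decr (SJ Su) (SJ St) tu; rewrite gt gu ltxx.
have [mZ Z0] : measurable Z /\ lebesgue_measure Z = 0%E.
  by have [->|->] := subset_set1 Zt0; rewrite ?measure0 ?lebesgue_measure_set1.
have -> : S = signed_part false `|` signed_part true `|` Z.
  apply/seteqP; split=> [t St|t [[[]|[]]|[]]//].
  have [g0|g0|g0] := ltgtP (g t) 0.
  - by left; right; split => //=; rewrite expr1 mulN1r oppr_gt0.
  - by left; left; split => //=; rewrite expr0 mul1r.
  - by right.
have mU := measurableU _ _ (mP false) (mP true).
apply: (le_trans (measureU2 lebesgue_measure mU mZ)).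
rewrite [X in (_ + X)%E]Z0 adde0.
apply: (le_trans (measureU2 lebesgue_measure (mP false) (mP true))).
apply: (le_trans (leeD (measure_signed_part _) (measure_signed_part _))).
rewrite -EFinD lee_fin.
have sm : Num.sqrt m != 0 by rewrite gt_eqF// sqrtr_gt0.
by rewrite (_ : _ + _ = 4 * A / Num.sqrt m)//; field.
Qed.

End Sojourn.

(** * Two-sided derivatives at interior times *)

Section Trajectory.
Context {R : realType} {d : nat}.
Variables (T : \bar R) (x : R -> 'rV[R]_d).

Definition open_time_interval : set R := [set t | 0 < t /\ (t%:E < T)%E].

Lemma is_interval_open_time_interval : is_interval open_time_interval.
Proof.
move=> a b [a0 _] [_ bT] t /andP[at_ tb]; split.
  exact: lt_le_trans at_.
by rewrite (le_lt_trans _ bT)// lee_fin.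
Qed.

Lemma open_open_time_interval : open open_time_interval.
Proof.
rewrite (_ : open_time_interval =
  [set t | 0 < t] `&` [set t | (t%:E < T)%E]) //.
by apply: openI; [exact: open_gt|exact: open_ereal_lt].
Qed.

(** All times near an interior t belong to the time interval, so the restricted limit is the full
    one; it is then rewritten with s = h + t. *)
Lemma is_derive_of_has_deriv_within t v : open_time_interval t ->
  has_deriv_within (time_interval T) x t v -> is_derive t 1 x v.
Proof.
move=> Jt xtv.
suff xv : h^-1 *: (x (h *: 1 + t) - x t) @[h --> 0^'] --> v.
  by split; [exact: cvgP xv|exact: cvg_lim xv].
apply/cvgrPdist_lt => e e0.
move/cvgrPdist_lt : xtv => /(_ _ e0) xtv.
have [r /= r0 rP] : \forall s \near t, s != t ->
    `|v - (s - t)^-1 *: (x s - x t)| < e.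
  have Jnear : nbhs t open_time_interval.
    exact: open_nbhs_nbhs (conj open_open_time_interval Jt).
  have {}xtv : \forall s \near t, s != t -> time_interval T s ->
    `|v - (s - t)^-1 *: (x s - x t)| < e := xtv.
  apply: filterS2 xtv Jnear => s + [s0 sT] st.
  by apply=> //; split => //; exact: ltW.
exists r => //= h /=; rewrite sub0r normrN => hr h0.
rewrite [h *: 1]mulr1.
have := rP (h + t); rewrite addrK; apply.
  by rewrite /= opprD addrCA subrr addr0 normrN.
by rewrite -subr_eq0 addrK.
Qed.

End Trajectory.

(** * The sojourn bound near a non-degenerate saddle point *)

Unset Implicit Arguments.

Theorem theorem11 (R : realType) (d : nat) (f : 'rV[R]_d -> R) (C : R)
    (xstar : 'rV[R]_d)
    (f_C2 : classC2 f) (C_gt4 : 4 < C)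
    (xstar_saddle : saddle_point f xstar)
    (xstar_nondegenerate : nondegenerate_at f xstar) :
  exists2 rbar : R, 0 < rbar &
    forall r : R, 0 < r < rbar ->
    forall (x0 : 'rV[R]_d) (T : \bar R) (x : R -> 'rV[R]_d),
      NGD_maximal_solution f x0 T x ->
      ~ closure (trajectory_orbit T x) xstar ->
      (lebesgue_measure
         [set t | time_interval T t /\ eball xstar r (x t)]
       <= (C * Num.sqrt (condition_number (hessian f xstar)) * r)%:E)%E.
Proof.
have [df dgrad _] := f_C2; have [grad0 not_min _] := xstar_saddle.
(* For d = 0 the space is a single point, which would be a local minimum. *)
have d_gt0 : (0 < d)%N.
  rewrite lt0n; apply/eqP => d0; apply: not_min.
  rewrite /local_min; near=> y.
  rewrite (_ : y = xstar)//; apply/rowP => i.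
  by have := ltn_ord i; rewrite [X in (_ < X)%N]d0.
have [m [L [/andP[m0 mL] -> mP LP]]] :=
  condition_number_bounds d_gt0 (hessian_sym df (dgrad xstar))
    xstar_nondegenerate.
have L0 : 0 < L by exact: lt_le_trans mL.
have [rbar rbar0 rbarP] := nondegenerate_critical_bounds df (dgrad xstar) grad0
  (introT andP (conj m0 mL)) (fun w => introT andP (conj (mP w) (LP w))).
exists rbar => // r /andP[r0 r_rbar] x0 T x [[T0 _ _ xNGD] _] _.
have [r_ge0 L_ge0 m_ge0] := And3 (ltW r0) (ltW L0) (ltW m0).
pose J := open_time_interval T.
(* The time 0 is left out since only a one-sided derivative exists there. *)
pose S := [set t | J t /\ eball xstar r (x t)].
pose g t := f (x t) - f xstar.
pose n t := enorm (grad f (x t)).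
have JT t : J t -> time_interval T t by move=> [/ltW].
have dx t : J t -> is_derive t 1 x (- ((n t)^-1 *: grad f (x t))).
  move=> Jt; apply: (is_derive_of_has_deriv_within Jt).
  by have [_] := xNGD _ (JT _ Jt).
have n_gt0 t : J t -> 0 < n t.
  by move=> /JT/xNGD[? _]; exact: enorm_gt0.
have x_cont t : J t -> {for t, continuous x}.
  by move=> /dx ?; apply: differentiable_continuous; exact/derivable1_diffP.
have S_open : open S.
  rewrite openE => t [Jt xt]; apply: filterI.
    by apply: open_nbhs_nbhs; split => //; exact: open_open_time_interval.
  have : {for t, continuous (fun s => enorm (x s - xstar))}.
    apply: continuous_comp; last exact: continuous_enorm.
    by apply: continuousB; [exact: x_cont|exact: cst_continuous].
  by move=> /(_ _ (lt_nbhsl xt)).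
have eball_bounds t : S t ->
    `|g t| <= L * enorm (x t - xstar) ^+ 2 /\ m * `|g t| <= n t ^+ 2.
  move=> [_ xt]; have := rbarP (x t - xstar) (lt_trans xt r_rbar).
  by rewrite (addrC xstar) subrK.
(* The choice A = sqrt(L) r comes from |g| <= L |x - xstar|^2 <= L r^2 in the ball. *)
have Sle : (lebesgue_measure S <=
    (4 * (Num.sqrt L * r) / Num.sqrt m)%:E)%E.
  apply: (@sojourn_measure_le _ J S g n) => //.
  - exact: is_interval_open_time_interval.
  - by move=> t [].
  - move=> t Jt; have dfx := is_derive_along_curve (df (x t)) (dx t Jt).
    have dfx' : is_derive t 1 (fun t => f (x t)) _ := dfx.
    (* The chain rule gives g' = -n^2 / n = -n. *)
    apply: is_derive_eq; rewrite subr0 dotNr dotZr -sqr_enorm -/(n t) expr2.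
    by rewrite mulKf ?gt_eqF ?n_gt0.
  - move=> t Jt; apply: continuous_comp; last exact: continuous_enorm.
    apply: continuous_comp; first exact: x_cont.
    exact: differentiable_continuous.
  - by rewrite mulr_ge0 ?sqrtr_ge0.
  - move=> t St; have [gt _] := eball_bounds _ St; apply: (le_trans gt).
    rewrite exprMn (sqr_sqrtr L_ge0) ler_wpM2l//.
    case: St => _ /ltW xt.
    by rewrite ler_sqr ?nnegrE ?enorm_ge0.
  - by move=> t /eball_bounds[].
pose B := [set t | time_interval T t /\ eball xstar r (x t)].
(* Time 0 is put back: it adds at most one point, a null set. *)
have BE : B = S `|` (B `&` [set 0]).
  apply/seteqP; split=> [t /[dup] Bt [[t0 tT] xt]|t [[/JT ? ?]|[]]//].
  move: t0; rewrite le_eqVlt => /predU1P[t0|t0]; last by left.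
  by right; split=> //=; rewrite -t0.
have mS : measurable S by exact: open_measurable.
have [mB0 B0] : measurable (B `&` [set 0]) /\
    lebesgue_measure (B `&` [set 0]) = 0%E.
  have [->|->] := subset_set1 (@subIsetr _ B [set 0]).
    by rewrite measure0.
  by rewrite lebesgue_measure_set1.
rewrite -/B BE; apply: (le_trans (measureU2 lebesgue_measure mS mB0)).
rewrite [X in (_ + X)%E]B0 adde0; apply: (le_trans Sle).
rewrite lee_fin sqrtrM// sqrtrV//.
rewrite (_ : 4 * _ / _ = 4 * (Num.sqrt L / Num.sqrt m) * r); last by ring.
by rewrite !ler_wpM2r// ?ltW// divr_ge0 ?sqrtr_ge0.
Unshelve. all: by end_near.
Qed.
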